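(* Let $R$ be a commutative ring. The Grothendieck group of the multiplicative monoid of non-zero-divisors of $R$ is canonically isomorphic to $T(R)^{\ast}$, the group of units of the total ring of fractions $T(R)$ of $R$.
   Context: All rings are commutative. $T(R)=S^{-1}R$ where $S$ is the set of non-zero-divisors of $R$. $A^{\ast}$ denotes the group of units of a ring $A$. The Grothendieck group of a (multiplicatively written) commutative monoid $N$ is the set of equivalence classes $[s,t]$ of pairs $(s,t)\in N\times N$ under $(s,t)\sim(s',t')$ iff there is $u\in N$ with $st'u=ts'u$, with operation $[s,t]\cdot[s',t']=[ss',tt']$. The canonical map sends $[s,t]$ to $s/t\in T(R)$. *)

(* Defs.v *)
From HB Require Import structures.
From mathcomp Require Import all_boot all_order all_algebra.
From mathcomp Require Import boolp ring.

Set Implicit Arguments.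
Unset Strict Implicit.
Unset Printing Implicit Defensive.

Import GRing.Theory.
Local Open Scope quotient_scope.

HB.mixin Record Monoid_isCommutative N of Monoid N := {
  cmulgC : commutative (@monoid.mul N)
}.

#[short(type="comMonoidType")]
HB.structure Definition ComMonoid := {N of Monoid_isCommutative N & Monoid N}.

HB.instance Definition _ (N : comMonoidType) :=
  SemiGroup.isCommutativeLaw.Build N (@monoid.mul N) (@cmulgC N).

Section Grothendieck.
Local Open Scope group_scope.
Variable N : comMonoidType.
Implicit Types p q r : N * N.

Definition groth_rel p q : bool :=
  `[< exists u : N, p.1 * q.2 * u = p.2 * q.1 * u >].

Lemma groth_relP p q :
  reflect (exists u : N, p.1 * q.2 * u = p.2 * q.1 * u) (groth_rel p q).
Proof. exact: asboolP. Qed.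

Lemma groth_rel_refl : reflexive groth_rel.
Proof. by move=> p; apply/groth_relP; exists 1; rewrite (cmulgC p.1). Qed.

Lemma groth_rel_sym : symmetric groth_rel.
Proof.
have sub p q : groth_rel p q -> groth_rel q p.
  case/groth_relP=> u e; apply/groth_relP; exists u.
  by rewrite (cmulgC q.1) (cmulgC q.2).
by move=> p q; apply/idP/idP; apply: sub.
Qed.

Lemma groth_rel_trans : transitive groth_rel.
Proof.
move=> [b s'] [a s] [c s''] /groth_relP[/= u eu] /groth_relP[/= v ev].
apply/groth_relP; exists (s' * (u * v)) => /=.
rewrite (AC (2*(1*2)) ((1*3*4)*(2*5))) /= eu.
by rewrite (AC (3*2) ((2*4*5)*(1*3))) /= ev (AC (3*2) (4*2*(1*(5*3)))).
Qed.

Canonical groth_equiv :=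
  EquivRel groth_rel groth_rel_refl groth_rel_sym groth_rel_trans.

Definition grothendieck := {eq_quot groth_rel}.
HB.instance Definition _ := EqQuotient.on grothendieck.
HB.instance Definition _ := Choice.on grothendieck.

Definition groth (s t : N) : grothendieck := \pi_(grothendieck) (s, t).

Lemma grothP (s t s' t' : N) :
  groth s t = groth s' t' <-> exists u : N, s * t' * u = t * s' * u.
Proof.
split=> [/eqmodP/groth_relP //|e].
by apply/eqmodP/groth_relP.
Qed.

Lemma grothW (P : grothendieck -> Prop) :
  (forall s t, P (groth s t)) -> forall x, P x.
Proof. by move=> H; elim/quotW=> -[s t]; apply: H. Qed.

Definition groth_mul : grothendieck -> grothendieck -> grothendieck :=
  lift_op2 grothendieck (fun p q => (p.1 * q.1, p.2 * q.2)).
Definition groth_inv : grothendieck -> grothendieck :=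
  lift_op1 grothendieck (fun p => (p.2, p.1)).

Lemma groth_mulE (s t s' t' : N) :
  groth_mul (groth s t) (groth s' t') = groth (s * s') (t * t').
Proof.
rewrite /groth_mul; unlock; apply/grothP.
have : groth (repr (groth s t)).1 (repr (groth s t)).2 = groth s t.
  by rewrite /groth -surjective_pairing reprK.
have : groth (repr (groth s' t')).1 (repr (groth s' t')).2 = groth s' t'.
  by rewrite /groth -surjective_pairing reprK.
move=> /grothP[v ev] /grothP[u eu]; exists (u * v).
rewrite /= (AC (2*2*2) ((1*3*5)*(2*4*6))) /=.
by rewrite (AC (2*2*2) ((1*3*5)*(2*4*6))) /= eu ev.
Qed.

Lemma groth_invE (s t : N) : groth_inv (groth s t) = groth t s.
Proof.
rewrite /groth_inv; unlock; apply/grothP.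
have : groth (repr (groth s t)).1 (repr (groth s t)).2 = groth s t.
  by rewrite /groth -surjective_pairing reprK.
by move=> /grothP[u eu]; exists u.
Qed.

Lemma groth_mulA : associative groth_mul.
Proof.
elim/grothW=> a b; elim/grothW=> c d; elim/grothW=> e f.
by rewrite !groth_mulE !mulgA.
Qed.

Lemma groth_mul1g : left_id (groth 1 1) groth_mul.
Proof. by elim/grothW=> a b; rewrite groth_mulE !mul1g. Qed.

Lemma groth_mulg1 : right_id (groth 1 1) groth_mul.
Proof. by elim/grothW=> a b; rewrite groth_mulE !mulg1. Qed.

Lemma groth_mulVg : left_inverse (groth 1 1) groth_inv groth_mul.
Proof.
elim/grothW=> a b; rewrite groth_invE groth_mulE; apply/grothP.
by exists 1; rewrite !mulg1 cmulgC.
Qed.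

Lemma groth_mulgV : right_inverse (groth 1 1) groth_inv groth_mul.
Proof.
elim/grothW=> a b; rewrite groth_invE groth_mulE; apply/grothP.
by exists 1; rewrite !mulg1 cmulgC.
Qed.

HB.instance Definition _ := isGroup.Build grothendieck
  groth_mulA groth_mul1g groth_mulg1 groth_mulVg groth_mulgV.

Lemma grothM (s t s' t' : N) :
  groth s t * groth s' t' = groth (s * s') (t * t').
Proof. exact: groth_mulE. Qed.

End Grothendieck.

Arguments grothendieck N : clear implicits.

Local Open Scope ring_scope.

Section Submonoid.
Variables (R : comPzRingType) (S : mulrClosed R).

Record submonoid := Submonoid { monval :> R; _ : monval \in S }.
HB.instance Definition _ := [isSub for monval].
HB.instance Definition _ := [Choice of submonoid by <:].

Definition submonoid_one : submonoid := Submonoid (rpred1 S).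
Definition submonoid_mul (x y : submonoid) : submonoid :=
  Submonoid (rpredM (valP x) (valP y)).

Lemma submonoid_mulA : associative submonoid_mul.
Proof. by move=> x y z; apply: val_inj; rewrite /= mulrA. Qed.
Lemma submonoid_mul1 : left_id submonoid_one submonoid_mul.
Proof. by move=> x; apply: val_inj; rewrite /= mul1r. Qed.
Lemma submonoid_mulr1 : right_id submonoid_one submonoid_mul.
Proof. by move=> x; apply: val_inj; rewrite /= mulr1. Qed.
HB.instance Definition _ := isMonoid.Build submonoid
  submonoid_mulA submonoid_mul1 submonoid_mulr1.

Lemma monvalM (x y : submonoid) : monval (x * y)%g = monval x * monval y.
Proof. by []. Qed.
Lemma monval1 : monval (1%g : submonoid) = 1.
Proof. by []. Qed.

Lemma submonoid_mulC : commutative (@monoid.mul submonoid).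
Proof. by move=> x y; apply: val_inj; rewrite /= mulrC. Qed.
HB.instance Definition _ := Monoid_isCommutative.Build submonoid submonoid_mulC.

End Submonoid.

Section Localization.
Variables (R : comPzRingType) (S : mulrClosed R).
Local Notation M := (submonoid S).
Implicit Types p q : R * M.

Definition loc_rel p q : bool :=
  `[< exists u : M,
        p.1 * monval q.2 * monval u = monval p.2 * q.1 * monval u >].

Lemma loc_relP p q :
  reflect (exists u : M,
             p.1 * monval q.2 * monval u = monval p.2 * q.1 * monval u)
          (loc_rel p q).
Proof. exact: asboolP. Qed.

Lemma loc_rel_refl : reflexive loc_rel.
Proof. by move=> p; apply/loc_relP; exists 1%g; rewrite (mulrC p.1). Qed.

Lemma loc_rel_sym : symmetric loc_rel.
Proof.
have sub p q : loc_rel p q -> loc_rel q p.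
  case/loc_relP=> u e; apply/loc_relP; exists u.
  by rewrite (mulrC q.1) (mulrC (monval q.2)).
by move=> p q; apply/idP/idP; apply: sub.
Qed.

Lemma loc_rel_trans : transitive loc_rel.
Proof.
move=> [b s'] [a s] [c s''] /loc_relP[/= u eu] /loc_relP[/= v ev].
apply/loc_relP; exists (s' * (u * v))%g; rewrite /=.
transitivity (a * monval s' * monval u * (monval s'' * monval v));
  first by ring.
rewrite eu.
transitivity (b * monval s'' * monval v * (monval s * monval u));
  first by ring.
by rewrite ev; ring.
Qed.

Canonical loc_equiv := EquivRel loc_rel loc_rel_refl loc_rel_sym loc_rel_trans.

Definition localization := {eq_quot loc_rel}.
HB.instance Definition _ := EqQuotient.on localization.
HB.instance Definition _ := Choice.on localization.

Definition fracl (a : R) (s : M) : localization := \pi_(localization) (a, s).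

Lemma fraclP (a b : R) (s t : M) :
  fracl a s = fracl b t
  <-> exists u : M, a * monval t * monval u = monval s * b * monval u.
Proof.
split=> [/eqmodP/loc_relP //|e].
by apply/eqmodP/loc_relP.
Qed.

Lemma fraclW (P : localization -> Prop) :
  (forall a s, P (fracl a s)) -> forall x, P x.
Proof. by move=> H; elim/quotW=> -[a s]; apply: H. Qed.

Lemma fracl_repr x : fracl (repr x).1 (repr x).2 = x.
Proof. by rewrite /fracl -surjective_pairing reprK. Qed.

Definition loc_add : localization -> localization -> localization :=
  lift_op2 localization
    (fun p q => (p.1 * monval q.2 + q.1 * monval p.2, (p.2 * q.2)%g)).
Definition loc_opp : localization -> localization :=
  lift_op1 localization (fun p => (- p.1, p.2)).
Definition loc_mul : localization -> localization -> localization :=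
  lift_op2 localization (fun p q => (p.1 * q.1, (p.2 * q.2)%g)).

Lemma loc_addE (a b : R) (s t : M) :
  loc_add (fracl a s) (fracl b t)
  = fracl (a * monval t + b * monval s) (s * t)%g.
Proof.
rewrite /loc_add; unlock; apply/fraclP.
have /fraclP[u eu] := fracl_repr (fracl a s).
have /fraclP[v ev] := fracl_repr (fracl b t).
exists (u * v)%g; rewrite /=.
set a' := (repr (fracl a s)).1 in eu *.
set s' := monval (repr (fracl a s)).2 in eu *.
set b' := (repr (fracl b t)).1 in ev *.
set t' := monval (repr (fracl b t)).2 in ev *.
transitivity (a' * monval s * monval u * (t' * monval t * monval v)
            + b' * monval t * monval v * (s' * monval s * monval u));
  first by ring.
by rewrite eu ev; ring.
Qed.

Lemma loc_oppE (a : R) (s : M) : loc_opp (fracl a s) = fracl (- a) s.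
Proof.
rewrite /loc_opp; unlock; apply/fraclP.
have /fraclP[u eu] := fracl_repr (fracl a s).
by exists u; rewrite /= mulrN !mulNr eu.
Qed.

Lemma loc_mulE (a b : R) (s t : M) :
  loc_mul (fracl a s) (fracl b t) = fracl (a * b) (s * t)%g.
Proof.
rewrite /loc_mul; unlock; apply/fraclP.
have /fraclP[u eu] := fracl_repr (fracl a s).
have /fraclP[v ev] := fracl_repr (fracl b t).
exists (u * v)%g; rewrite /=.
set a' := (repr (fracl a s)).1 in eu *.
set s' := monval (repr (fracl a s)).2 in eu *.
set b' := (repr (fracl b t)).1 in ev *.
set t' := monval (repr (fracl b t)).2 in ev *.
transitivity (a' * monval s * monval u * (b' * monval t * monval v));
  first by ring.
by rewrite eu ev; ring.
Qed.

Lemma fracl_eq (a b : R) (s t : M) :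
  a * monval t = monval s * b -> fracl a s = fracl b t.
Proof. by move=> e; apply/fraclP; exists 1%g; rewrite e. Qed.

Lemma loc_addA : associative loc_add.
Proof.
elim/fraclW=> a s; elim/fraclW=> b t; elim/fraclW=> c w; rewrite !loc_addE.
by apply: fracl_eq; rewrite !monvalM; ring.
Qed.

Lemma loc_addC : commutative loc_add.
Proof.
elim/fraclW=> a s; elim/fraclW=> b t; rewrite !loc_addE.
by apply: fracl_eq; rewrite !monvalM; ring.
Qed.

Lemma loc_add0 : left_id (fracl 0 1%g) loc_add.
Proof.
elim/fraclW=> a s; rewrite loc_addE.
by apply: fracl_eq; rewrite monvalM monval1; ring.
Qed.

Lemma loc_addN : left_inverse (fracl 0 1%g) loc_opp loc_add.
Proof.
elim/fraclW=> a s; rewrite loc_oppE loc_addE.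
by apply: fracl_eq; rewrite monvalM monval1; ring.
Qed.

HB.instance Definition _ := GRing.isZmodule.Build localization
  loc_addA loc_addC loc_add0 loc_addN.

Lemma loc_mulA : associative loc_mul.
Proof.
elim/fraclW=> a s; elim/fraclW=> b t; elim/fraclW=> c w; rewrite !loc_mulE.
by apply: fracl_eq; rewrite !monvalM; ring.
Qed.

Lemma loc_mulC : commutative loc_mul.
Proof.
elim/fraclW=> a s; elim/fraclW=> b t; rewrite !loc_mulE.
by apply: fracl_eq; rewrite !monvalM; ring.
Qed.

Lemma loc_mul1 : left_id (fracl 1 1%g) loc_mul.
Proof.
elim/fraclW=> a s; rewrite loc_mulE.
by apply: fracl_eq; rewrite monvalM monval1; ring.
Qed.

Lemma loc_mulDl : left_distributive loc_mul +%R.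
Proof.
elim/fraclW=> a s; elim/fraclW=> b t; elim/fraclW=> c w.
rewrite -[fracl a s + _]/(loc_add _ _) -[RHS]/(loc_add _ _).
rewrite !loc_addE !loc_mulE loc_addE.
by apply: fracl_eq; rewrite !monvalM; ring.
Qed.

HB.instance Definition _ := GRing.Zmodule_isComPzRing.Build localization
  loc_mulA loc_mulC loc_mul1 loc_mulDl.

Lemma fraclD (a b : R) (s t : M) :
  fracl a s + fracl b t = fracl (a * monval t + b * monval s) (s * t)%g.
Proof. exact: loc_addE. Qed.

Lemma fraclM (a b : R) (s t : M) :
  fracl a s * fracl b t = fracl (a * b) (s * t)%g.
Proof. exact: loc_mulE. Qed.

Lemma fracl1 : fracl 1 1%g = 1.
Proof. by []. Qed.

End Localization.

Arguments localization {R} S.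

Section TotalFractions.
Variable R : comPzRingType.

Definition nonzerodivisor : {pred R} :=
  [pred a | `[< forall x : R, a * x = 0 -> x = 0 >]].

Lemma nonzerodivisorP (a : R) :
  reflect (forall x : R, a * x = 0 -> x = 0) (a \in nonzerodivisor).
Proof. exact: asboolP. Qed.

Lemma nonzerodivisor_closed : mulr_closed nonzerodivisor.
Proof.
split=> [|a b /nonzerodivisorP aP /nonzerodivisorP bP].
  by apply/nonzerodivisorP=> x; rewrite mul1r.
by apply/nonzerodivisorP=> x; rewrite -mulrA => /aP/bP.
Qed.

HB.instance Definition _ :=
  GRing.isMulClosed.Build R nonzerodivisor nonzerodivisor_closed.

Definition nzd_monoid := submonoid nonzerodivisor.
HB.instance Definition _ := ComMonoid.on nzd_monoid.

Definition total_fractions := localization nonzerodivisor.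
HB.instance Definition _ := GRing.ComPzRing.on total_fractions.

Definition total_frac (a : R) (s : nzd_monoid) : total_fractions := fracl a s.

End TotalFractions.

Arguments nzd_monoid R : clear implicits.
Arguments total_fractions R : clear implicits.

(* GRing.unit needs a unitRingType, hence a nontrivial ring, whereas the zero
   ring is allowed here; 0 is then a non-zero-divisor and a unit. *)
Section Units.
Variable A : comPzRingType.

Definition is_unit : {pred A} := [pred x | `[< exists y : A, x * y = 1 >]].

Lemma is_unitP (x : A) : reflect (exists y : A, x * y = 1) (x \in is_unit).
Proof. exact: asboolP. Qed.

Record units := Units { units_val :> A; _ : units_val \in is_unit }.
HB.instance Definition _ := [isSub for units_val].
HB.instance Definition _ := [Choice of units by <:].

Lemma units_one_subproof : 1 \in is_unit.
Proof. by apply/is_unitP; exists 1; rewrite mulr1. Qed.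
Definition units_one : units := Units units_one_subproof.

Lemma units_mul_subproof (u v : units) : val u * val v \in is_unit.
Proof.
have /is_unitP[x ux] := valP u; have /is_unitP[y vy] := valP v.
by apply/is_unitP; exists (x * y); rewrite mulrACA ux vy mulr1.
Qed.
Definition units_mul (u v : units) : units := Units (units_mul_subproof u v).

Lemma units_inv_subproof (u : units) : exists v : units, val v * val u = 1.
Proof.
have /is_unitP[x ux] := valP u.
have xU : x \in is_unit by apply/is_unitP; exists (val u); rewrite mulrC.
by exists (Units xU); rewrite /= mulrC.
Qed.
Definition units_inv (u : units) : units := sval (cid (units_inv_subproof u)).

Lemma units_mulA : associative units_mul.
Proof. by move=> u v w; apply: val_inj; rewrite /= mulrA. Qed.
Lemma units_mul1g : left_id units_one units_mul.
Proof. by move=> u; apply: val_inj; rewrite /= mul1r. Qed.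
Lemma units_mulg1 : right_id units_one units_mul.
Proof. by move=> u; apply: val_inj; rewrite /= mulr1. Qed.
Lemma units_mulVg : left_inverse units_one units_inv units_mul.
Proof. by move=> u; apply: val_inj; rewrite /= /units_inv; case: cid. Qed.
Lemma units_mulgV : right_inverse units_one units_inv units_mul.
Proof. by move=> u; apply: val_inj; rewrite /= mulrC /units_inv; case: cid. Qed.

HB.instance Definition _ := isGroup.Build units
  units_mulA units_mul1g units_mulg1 units_mulVg units_mulgV.

End Units.

Arguments units A : clear implicits.

(* Main.v *)
Require Import Defs.
From HB Require Import structures.
From mathcomp Require Import all_boot all_order all_algebra.
From mathcomp Require Import boolp.

(** A fraction a/s of T(R) with inverse b/t satisfies abu = stu for some
    non-zero-divisor u; so a divides a non-zero-divisor and is one itself.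
    Hence the units of T(R) are exactly the fractions s/t of two
    non-zero-divisors, and two such fractions are equal in T(R) exactly when
    [s,t] = [s',t'], because both equivalences quantify over the same u. *)

Set Implicit Arguments.
Unset Strict Implicit.
Unset Printing Implicit Defensive.

Import GRing.Theory.
Local Open Scope ring_scope.

Section UnitsOfTotalFractions.
Variable R : comPzRingType.
Implicit Types (a b : R) (s t u : nzd_monoid R).

Lemma nonzerodivisor_dvd a b :
  a * b \in @nonzerodivisor R -> a \in @nonzerodivisor R.
Proof.
move=> /nonzerodivisorP abP; apply/nonzerodivisorP=> x ax0.
by apply: abP; rewrite mulrAC ax0 mul0r.
Qed.

Lemma total_frac_unit s t : total_frac (monval s) t \in @is_unit _.
Proof.
apply/is_unitP; exists (total_frac (monval t) s).
by rewrite /total_frac fraclM -fracl1; apply: fracl_eq; rewrite /= !mulr1 mulrC.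
Qed.

Lemma total_frac_unit_nzd a t :
  total_frac a t \in @is_unit _ -> a \in @nonzerodivisor R.
Proof.
move=> /is_unitP[]; elim/fraclW=> b s.
rewrite /total_frac fraclM -fracl1 => /fraclP[u].
rewrite monval1 !mulr1 -mulrA => e.
(* Here [e] reads a(bu) = tsu, whose right side is a product of non-zero-divisors. *)
by apply: (@nonzerodivisor_dvd a (b * monval u)); rewrite e (valP (t * s * u)%g).
Qed.

(** Left to right gives well-definedness of the map on classes, right to left its injectivity. *)
Lemma eq_groth_total_frac s t s' t' :
  groth s t = groth s' t' <->
  total_frac (monval s) t = total_frac (monval s') t'.
Proof.
split=> [/grothP[u e]|/fraclP[u e]].
  by apply/fraclP; exists u; rewrite -!monvalM e.
by apply/grothP; exists u; apply: val_inj.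
Qed.

(** Built on the chosen representative [repr x]; [groth_fracE] shows that the choice does not
    matter. *)
Definition groth_frac (x : grothendieck (nzd_monoid R)) :
    units (total_fractions R) :=
  Units (total_frac_unit (repr x).1 (repr x).2).

Lemma groth_fracE s t :
  units_val (groth_frac (groth s t)) = total_frac (monval s) t.
Proof.
by apply/eq_groth_total_frac; rewrite /groth -surjective_pairing reprK.
Qed.

Lemma groth_fracM : {morph groth_frac : x y / (x * y)%g}.
Proof.
elim/grothW=> s t; elim/grothW=> s' t'; apply: val_inj.
rewrite grothM [LHS]groth_fracE -[RHS]/(units_val _ * units_val _).
by rewrite !groth_fracE /total_frac fraclM.
Qed.

HB.instance Definition _ :=
  isMultiplicative.Build _ _ groth_frac groth_fracM.

Lemma groth_frac_inj : injective groth_frac.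
Proof.
elim/grothW=> s t; elim/grothW=> s' t' /(congr1 (@units_val _)).
by rewrite !groth_fracE => /eq_groth_total_frac.
Qed.

Lemma groth_frac_surj v : exists x, groth_frac x = v.
Proof.
(* Since a/t is a unit, a is a non-zero-divisor, so [a,t] exists and maps to a/t. *)
case: v; elim/fraclW=> a t aU; pose s := Submonoid (total_frac_unit_nzd aU).
by exists (groth s t); apply: val_inj; apply: groth_fracE.
Qed.

Lemma groth_frac_bij : bijective groth_frac.
Proof.
(* A choice of preimages is a right inverse; injectivity makes it two-sided. *)
have [g gK] := choice groth_frac_surj.
by exists g => // x; apply: groth_frac_inj; rewrite gK.
Qed.

End UnitsOfTotalFractions.

Theorem corollary4p6 (R : comPzRingType) :
  exists f :
    {multiplicative grothendieck (nzd_monoid R) -> units (total_fractions R)},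
    bijective f
    /\ forall s t : nzd_monoid R,
         units_val (f (groth s t)) = total_frac (monval s) t.
Proof.
exists (@groth_frac R); split; first exact: groth_frac_bij.
exact: groth_fracE.
Qed.
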